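(* Let $\epsilon>0$. For any finite class $\mathcal{F}$ of $K$ functions $f:\mathcal{X}\to\mathcal{D}(\mathcal{Y})$, with any label set $\mathcal{Y}$ (of arbitrary size), there exist an $(\epsilon,0)$-locally differentially private privatization scheme $\mathcal{R}^T$ and a prediction scheme (learning rule) $\Phi^T$ such that, with adversarially generated features, the KL-risk satisfies $$\sup_{f\in\mathcal{F},\,\mathbf{x}^T\in\mathcal{X}^T}\mathbb{E}\left[\sum_{t=1}^T\mathsf{KL}(f(\mathbf{x}_t),\hat p_t)\right]=O\left(\frac1\epsilon\sqrt{KT\log^5(KT)}\right).$$
   Context: Setting (private online conditional distribution learning). $\mathcal{X}=\mathbb{R}^d$ is the feature space and $\mathcal{Y}=[M]=\{1,\dots,M\}$ is the label set, where $d$ and $M$ are arbitrary positive integers; $\mathcal{D}(\mathcal{Y})$ is the set of probability distributions on $\mathcal{Y}$. $\mathcal{F}=\{f_1,\dots,f_K\}$ is a class of functions $f_j:\mathcal{X}\to\mathcal{D}(\mathcal{Y})$, known to all parties, and $T$ is the time horizon. Nature picks an unknown $f\in\mathcal{F}$ and an arbitrary feature sequence $\mathbf{x}^T=(\mathbf{x}_1,\dots,\mathbf{x}_T)\in\mathcal{X}^T$. At each time $t=1,\dots,T$: $\mathbf{x}_t$ is revealed; the learner outputs $\hat p_t=\Phi_t(\mathbf{x}^t,\tilde{\mathbf{Y}}^{t-1})\in\mathcal{D}(\mathcal{Y})$, where $\mathbf{x}^t=(\mathbf{x}_1,\dots,\mathbf{x}_t)$ and $\tilde{\mathbf{Y}}^{t-1}=(\tilde{\mathbf{Y}}_1,\dots,\tilde{\mathbf{Y}}_{t-1})$;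 then a user samples $Y_t\sim f(\mathbf{x}_t)$ independently over $t$ and reveals to the learner only $\tilde{\mathbf{Y}}_t=\mathcal{R}_t(Y_t)\in\mathbb{R}^K$, where $\mathcal{R}_t$ is a randomized map from $\mathcal{Y}$ to $\mathbb{R}^K$ (which may depend on $\mathcal{F}$, $T$ and $\mathbf{x}_t$) with internal randomness independent across different $t$. A prediction scheme is $\Phi^T=(\Phi_1,\dots,\Phi_T)$ and a privatization scheme is $\mathcal{R}^T=(\mathcal{R}_1,\dots,\mathcal{R}_T)$. $\mathcal{R}^T$ is $(\epsilon,\delta)$-locally differentially private if for every $t$, all $y,y'\in\mathcal{Y}$ and every $S\subseteq\mathbb{R}^K$, $\Pr(\mathcal{R}_t(y)\in S)\le e^\epsilon\Pr(\mathcal{R}_t(y')\in S)+\delta$. $\mathsf{KL}(p_1,p_2)=\sum_{y\in\mathcal{Y}}p_1[y]\log\frac{p_1[y]}{p_2[y]}$. The expectation is over $\tilde{\mathbf{Y}}^T$. *)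

(* Defs.v *)
From HB Require Import structures.
From mathcomp Require Import all_boot all_order all_algebra.
From mathcomp Require Import all_classical all_reals all_analysis.

Set Implicit Arguments.
Unset Strict Implicit.
Unset Printing Implicit Defensive.

Import Order.TTheory GRing.Theory Num.Theory.

Local Open Scope classical_set_scope.
Local Open Scope ring_scope.

Section distributions.
Variables (R : realType) (M : nat).

(* The labels 1, ..., M are represented by the ordinals 0, ..., M-1. *)
Record distr := Distr {
  mass :> 'I_M -> R ;
  mass_ge0 : forall y, 0 <= mass y ;
  mass_sum1 : \sum_(y < M) mass y = 1 }.

(* p * log (p / q), natural logarithm, with the usual conventions
   0 log (0 / q) = 0 (also for q = 0) and p log (p / 0) = +oo for p > 0. *)
Definition KL_term (p q : R) : \bar R :=
  if p == 0 then 0%E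
  else if q == 0 then +oo%E
  else (p * ln (p / q))%:E.

Definition KL (p q : distr) : \bar R := (\sum_(y < M) KL_term (p y) (q y))%E.

End distributions.

Section mixture.
Local Open Scope ereal_scope.
Context d (Z : measurableType d) (R : realType) (M : nat).
Variables (p : distr R M) (k : 'I_M -> probability Z R).

(* Law of k(Y) when Y ~ p and the randomness of k is independent of Y. *)
Definition mixture (S : set Z) : \bar R := \sum_(y < M) (p y)%:E * k y S.

Let mixture0 : mixture set0 = 0.
Proof. by rewrite /mixture big1// => y _; rewrite measure0 mule0. Qed.

Let mixture_ge0 S : 0 <= mixture S.
Proof.
by apply: sume_ge0 => y _; rewrite mule_ge0// lee_fin mass_ge0.
Qed.

Let mixture_sigma_additive : semi_sigma_additive mixture.
Proof.
move=> F mF tF mUF; rewrite [X in _ --> X](_ : _ =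
    lim ((fun n => \sum_(0 <= i < n) mixture (F i)) @ \oo)).
  by apply: is_cvg_ereal_nneg_natsum => j _; exact: mixture_ge0.
rewrite nneseries_sum//; last first.
  by move=> y j _; rewrite mule_ge0// lee_fin mass_ge0.
apply: eq_bigr => /= y _.
rewrite nneseriesZl//.
by congr (_ * _); exact: measure_semi_bigcup.
Qed.

HB.instance Definition _ := isMeasure.Build _ _ _ mixture
  mixture0 mixture_ge0 mixture_sigma_additive.

Let mixture_setT : mixture setT = 1.
Proof.
rewrite /mixture (eq_bigr (fun y => (p y)%:E)).
  by rewrite sumEFin mass_sum1.
by move=> y _; rewrite probability_setT mule1.
Qed.

HB.instance Definition _ := Measure_isProbability.Build _ _ _ mixture
  mixture_setT.

End mixture.

Section product_law.
Context d (Z : measurableType d) (R : realType).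

Definition consp n (zs : Z * n.-tuple Z) : n.+1.-tuple Z :=
  [tuple of zs.1 :: zs.2].

Lemma measurable_consp n : measurable_fun setT (@consp n).
Proof. by apply: measurable_cons. Qed.

HB.instance Definition _ n :=
  isMeasurableFun.Build _ _ _ _ (@consp n) (@measurable_consp n).

(* Law of (Z_0, ..., Z_(n-1)) for independent Z_i ~ mu i; characterised by
   product_lawE below. *)
Fixpoint product_law n : ('I_n -> probability Z R) ->
    probability (n.-tuple Z) R :=
  match n with
  | 0 => fun _ => [the probability _ R of \d_([tuple] : 0.-tuple Z)]
  | m.+1 => fun mu =>
    [the probability _ R of
      distribution
        [the probability _ R of
          (mu ord0 \x @product_law m (fun i => mu (lift ord0 i)))%E]
        [the {mfun _ >-> _} of @consp m]]
  end.

Lemma product_lawE n (mu : 'I_n -> probability Z R) (A : 'I_n -> set Z) :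
  (forall i, measurable (A i)) ->
  product_law mu [set s | forall i, A i (tnth s i)] =
  (\prod_(i < n) mu i (A i))%E.
Proof.
elim: n mu A => [|n IHn] mu A mA /=.
  by rewrite big_ord0 diracE mem_set// => -[].
rewrite /distribution /pushforward big_ord_recl -IHn//.
have mB : measurable
    [set s : n.-tuple Z | forall i, A (lift ord0 i) (tnth s i)].
  rewrite (_ : mkset _ = \bigcap_(i in [set: 'I_n])
      ((fun s : n.-tuple Z => tnth s i) @^-1` A (lift ord0 i))).
    apply: fin_bigcap_measurable => // i _.
    by rewrite -[X in measurable X]setTI; exact: measurable_tnth.
  by apply/seteqP; split => s /= h i; [move=> _; exact: h | exact: h].
rewrite -product_measure1E//; congr (_ _).
apply/seteqP; split => -[z s] /=.
  move=> h; split => [|i]; first exact: (h ord0).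
  by have := h (lift ord0 i); rewrite tnthS.
move=> [Az As] i; have [j ->|->//] := unliftP ord0 i.
by rewrite tnthS.
Qed.

End product_law.

Definition first_entries A T n (nT : (n <= T)%N) (s : T.-tuple A) : n.-tuple A :=
  [tuple tnth s (widen_ord nT i) | i < n].

Section private_learning.
Variables (R : realType) (d M K T : nat).

Definition feature := 'rV[R]_d.

(* R^K with its Borel (product) sigma-algebra. *)
Definition private_label := K.-tuple (measurableTypeR R).

(* Time is 0-based: t : 'I_T stands for round t + 1. [priv t x y] is the law of
   the released vector at round t when the feature is x and the label is y. *)
Definition privatization :=
  'I_T -> feature -> 'I_M -> probability private_label R.

Definition locally_private (eps delta : R) (priv : privatization) :=
  forall t x y y' (S : set private_label), measurable S ->
  (priv t x y S <= (expR eps)%:E * priv t x y' S + delta%:E)%E.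

(* At round t the learner has seen t + 1 features and t private labels. *)
Definition prediction := forall t : 'I_T,
  t.+1.-tuple feature -> t.-tuple private_label -> distr R M.

Definition measurable_prediction (Phi : prediction) :=
  forall (t : 'I_T) xs y, measurable_fun [set: t.-tuple private_label]
    (fun zs => Phi t xs zs y : measurableTypeR R).

(* Law of the T private labels: independent over rounds, the label at round t
   being drawn from f (x_t) and then privatized. *)
Definition private_law (priv : privatization) (f : feature -> distr R M)
    (xs : T.-tuple feature) : probability (T.-tuple private_label) R :=
  product_law (fun t : 'I_T =>
    [the probability _ R of
      mixture (f (tnth xs t)) (priv t (tnth xs t))]).

Definition KL_risk (priv : privatization) (Phi : prediction)
    (f : feature -> distr R M) (xs : T.-tuple feature) : \bar R :=
  (\int[private_law priv f xs]_zs
     (\sum_(t < T) KL (f (tnth xs t))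
        (Phi t (first_entries (ltn_ord t) xs)
               (first_entries (ltnW (ltn_ord t)) zs)))%E)%E.

End private_learning.

(* Main.v *)
Require Import Defs.
From mathcomp Require Import all_boot all_order all_algebra.
From mathcomp Require Import all_classical all_reals all_analysis.
From mathcomp Require Import measurable_realfun ring lra.
Import Order.TTheory GRing.Theory Num.Theory.
Local Open Scope classical_set_scope.
Local Open Scope ring_scope.

(* Each f_j is smoothed with the uniform average u of the class, to
   (T f_j + u) / (T + 1). The log-loss of the smoothed f_j relative to u is then
   bounded by L = ln (KT) whatever the number of labels, and the smoothing costs
   at most 1/T per round. The user privatizes the K losses by choosing one
   coordinate j uniformly at random and releasing B e_j or - B e_j, the sign
   being a randomized response biased by the j-th loss; with B = L K / rho and
   rho = (e^eps - 1) / (e^eps + 1) this is an unbiased estimate of the loss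
   vector, each coordinate of which has second moment B^2 / K. Exponential
   weights on these estimates, with learning rate eta such that eta B <= 1, have
   expected regret at most ln K / eta + 2 T eta B^2 / K, and the KL-risk is
   bounded through convexity of KL in its second argument. If T < K ln K no
   admissible eta is good enough, but then predicting u has risk
   T ln K <= sqrt (T K ln K) ln K. *)

(** * Integrals against mixtures and product laws *)

Section integration.
Set Implicit Arguments.
Unset Strict Implicit.
Unset Printing Implicit Defensive.
Context {R : realType}.

Lemma integral_probability_cst d (Z : measurableType d) (P : probability Z R)
    (a : \bar R) :
  (\int[P]_z a = a)%E.
Proof.
rewrite integral_cst// -[RHS]mule1; congr (_ * _)%E.
exact: (probability_setT P).
Qed.

Lemma ge0_integral_mixture d (Z : measurableType d) M (p : distr R M)
    (k : 'I_M -> probability Z R) (F : Z -> \bar R) :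
  measurable_fun setT F -> (forall z, 0 <= F z)%E ->
  (\int[mixture p k]_z F z = \sum_(y < M) (p y)%:E * \int[k y]_z F z)%E.
Proof.
move=> mF F0.
(* [msum] takes measures indexed by natural numbers, so the labels are recovered by [insub], with
   the zero measure as filler. *)
pose m_ i : measure Z R := match insub i with
  | Some y => mscale (NngNum (mass_ge0 p y)) (k y)
  | None => mzero end.
rewrite (eq_measure_integral (msum m_ M)).
  rewrite ge0_integral_measure_sum//; apply: eq_bigr => y _.
  by rewrite /m_ valK ge0_integral_mscale.
move=> A mA _; rewrite /mixture /msum /=; apply: eq_bigr => y _.
by rewrite /m_ valK.
Qed.

(** Tonelli with the first round split off, the form needed for an induction on the number of
    rounds. *)
Lemma ge0_integral_product_law d (Z : measurableType d) n
    (mu : 'I_n.+1 -> probability Z R) (g : n.+1.-tuple Z -> \bar R) :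
  measurable_fun setT g -> (forall s, 0 <= g s)%E ->
  (\int[product_law mu]_s g s =
   \int[mu ord0]_z \int[product_law (fun i => mu (lift ord0 i))]_s
      g [tuple of z :: s])%E.
Proof.
move=> mg g0 /=; rewrite ge0_integral_distribution// fubini_tonelli1//.
- exact: measurableT_comp mg (@measurable_consp _ _ _).
- by move=> x; exact: g0.
Qed.

Lemma measurable_cons_tuple d (Z : measurableType d) n (z : Z) :
  measurable_fun [set: n.-tuple Z] (fun s => [tuple of z :: s]).
Proof.
exact: (measurable_cons (measurable_cst z) (@measurable_id _ _ _)).
Qed.

(* The potential V dominates the expected loss still to be paid, up to c per
   round. *)
Lemma online_integral_le d (Z : measurableType d) (St : Type)
    (step : St -> Z -> St) (V : St -> R) (c : R) N (zz : 'I_N -> Z) n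
    (mu : 'I_n -> probability Z R) (q : 'I_n -> distr R N)
    (h : 'I_n -> St -> R) (s0 : St) :
  (forall s, 0 <= V s) -> (forall t s, 0 <= h t s) ->
  (forall t (F : Z -> \bar R), measurable_fun setT F -> (forall z, 0 <= F z)%E ->
     (\int[mu t]_z F z = \sum_(a < N) (q t a)%:E * F (zz a))%E) ->
  (forall t s, h t s + \sum_(a < N) q t a * V (step s (zz a)) <= V s + c) ->
  (forall t : 'I_n, measurable_fun [set: n.-tuple Z]
     (fun zs => h t (foldl step s0 (take t zs)))) ->
  (\int[product_law mu]_zs
      (\sum_(t < n) h t (foldl step s0 (take t zs)))%:E
   <= (V s0 + n%:R * c)%:E)%E.
Proof.
move=> V0; elim: n mu q h s0 => [|n IHn] mu q h s0 h0 muE hV mh.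
  under eq_integral do rewrite big_ord0.
  by rewrite integral0 mul0r addr0 lee_fin.
rewrite ge0_integral_product_law//; last 2 first.
- by apply/measurable_EFinP; exact: measurable_sum.
- by move=> s; rewrite lee_fin sumr_ge0.
pose P : probability (n.-tuple Z) R := product_law (fun i => mu (lift ord0 i)).
pose G z := (\int[P]_s
   (\sum_(t < n) h (lift ord0 t) (foldl step (step s0 z) (take t s)))%:E)%E.
have mh' (z : Z) (t : 'I_n) : measurable_fun [set: n.-tuple Z]
    (fun zs => h (lift ord0 t) (foldl step (step s0 z) (take t zs))).
  exact: (measurableT_comp (mh (lift ord0 t)) (@measurable_cons_tuple _ _ _ z)).
have G0 z : (0 <= G z)%E.
  by apply: integral_ge0 => s _; rewrite lee_fin sumr_ge0.
(* The first loss is paid in the state [s0], before any outcome, hence it is constant in [z]. *)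
have eqG z : (\int[P]_s (\sum_(t < n.+1)
    h t (foldl step s0 (take t [tuple of z :: s])))%:E
    = (h ord0 s0)%:E + G z)%E.
  under eq_integral => s _ do rewrite big_ord_recl /= EFinD.
  rewrite ge0_integralD//=; last 3 first.
  - by move=> s _; rewrite lee_fin.
  - by move=> s _; rewrite lee_fin sumr_ge0.
  - by apply/measurable_EFinP; exact: measurable_sum.
  by rewrite integral_probability_cst.
under eq_integral => z _ do rewrite eqG.
have mG : measurable_fun setT G.
  apply: (@measurable_fun_fubini_tonelli_F _ _ _ _ _ P (fun zs =>
    (\sum_(t < n) h (lift ord0 t)
       (foldl step s0 (take (lift ord0 t) (consp zs))))%:E)).
    apply/measurable_EFinP/measurable_sum => t.
    exact: measurableT_comp (mh (lift ord0 t)) (@measurable_consp _ _ _).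
  by move=> s; rewrite lee_fin sumr_ge0.
rewrite ge0_integralD//=; last first.
  by move=> z _; rewrite lee_fin.
rewrite integral_probability_cst muE//.
have GV z : (G z <= (V (step s0 z) + n%:R * c)%:E)%E.
  apply: (IHn (fun i => mu (lift ord0 i)) (fun i => q (lift ord0 i))
    (fun i => h (lift ord0 i))) => //.
  by move=> t; exact: muE.
apply: (@le_trans _ _ ((h ord0 s0)%:E + (\sum_(a < N)
   (q ord0 a)%:E * (V (step s0 (zz a)) + n%:R * c)%:E))%E).
  by rewrite leeD2l// lee_sum// => a _; rewrite lee_wpmul2l// lee_fin mass_ge0.
under eq_bigr do rewrite -EFinM mulrDr.
(* The weights [q ord0] sum to 1, so the cost [n%:R * c] of the later rounds leaves the average;
   [hV] at [s0] supplies one more [c]. *)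
rewrite sumEFin big_split /= -mulr_suml mass_sum1 mul1r -EFinD lee_fin.
by have := hV ord0 s0; rewrite -[n.+1%:R]natr1 mulrDl mul1r; lra.
Qed.

End integration.

(** * Blending, smoothing and real-valued divergence *)

Section distributions.
Set Implicit Arguments.
Unset Strict Implicit.
Unset Printing Implicit Defensive.
Context {R : realType}.

Lemma uniform_sum1 K : (0 < K)%N -> \sum_(j < K) (K%:R^-1 : R) = 1.
Proof.
move=> K_gt0; rewrite sumr_const card_ord -[LHS]mulr_natr mulVf//.
by rewrite pnatr_eq0 -lt0n.
Qed.

Definition uniform_distr K (K_gt0 : (0 < K)%N) : distr R K :=
  Distr (fun=> eqbRL (invr_ge0 _) (ler0n R K)) (uniform_sum1 K_gt0).

(** It serves three times: for the class average, for the prediction of the learner, and for the law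
    of the released index once the label is averaged out. *)
Definition blend_mass K M (w : distr R K) (p : 'I_K -> distr R M) y :=
  \sum_(j < K) w j * p j y.

Lemma blend_ge0 K M (w : distr R K) (p : 'I_K -> distr R M) y :
  0 <= blend_mass w p y.
Proof. by apply: sumr_ge0 => j _; rewrite mulr_ge0 ?mass_ge0. Qed.

Lemma blend_sum1 K M (w : distr R K) (p : 'I_K -> distr R M) :
  \sum_(y < M) blend_mass w p y = 1.
Proof.
rewrite exchange_big -[RHS](mass_sum1 w); apply: eq_bigr => j _ /=.
by rewrite -mulr_sumr mass_sum1 mulr1.
Qed.

Definition blend K M (w : distr R K) (p : 'I_K -> distr R M) : distr R M :=
  Distr (blend_ge0 w p) (blend_sum1 w p).

Lemma sum_blend K M (w : distr R K) (p : 'I_K -> distr R M) (g : 'I_M -> R) :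
  \sum_(y < M) blend w p y * g y = \sum_(j < K) w j * \sum_(y < M) p j y * g y.
Proof.
under eq_bigr do rewrite mulr_suml.
rewrite exchange_big; apply: eq_bigr => j _ /=.
by rewrite mulr_sumr; apply: eq_bigr => y _; rewrite mulrA.
Qed.

Definition smooth_mass M T (p u : distr R M) y :=
  (T%:R * p y + u y) / (T%:R + 1) : R.

Lemma smooth_ge0 M T (p u : distr R M) y : 0 <= smooth_mass T p u y.
Proof.
by rewrite divr_ge0 ?addr_ge0 ?mulr_ge0 ?mass_ge0 ?ler01 ?ler0n.
Qed.

Lemma smooth_sum1 M T (p u : distr R M) : \sum_(y < M) smooth_mass T p u y = 1.
Proof.
by rewrite -mulr_suml big_split /= -mulr_sumr !mass_sum1 mulr1 divff.
Qed.

Definition smooth M T (p u : distr R M) : distr R M :=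
  Distr (smooth_ge0 T p u) (smooth_sum1 T p u).

Lemma smooth_ge_l M T (p u : distr R M) y :
  T%:R / (T%:R + 1) * p y <= smooth T p u y.
Proof.
rewrite mulrAC ler_wpM2r ?invr_ge0 ?addr_ge0 ?ler01 ?ler0n//.
by rewrite lerDl mass_ge0.
Qed.

Lemma smooth_ge_r M T (p u : distr R M) y :
  u y / (T%:R + 1) <= smooth T p u y.
Proof.
rewrite ler_wpM2r ?invr_ge0 ?addr_ge0 ?ler01 ?ler0n//.
by rewrite lerDr mulr_ge0 ?mass_ge0 ?ler0n.
Qed.

Lemma le_uniform_blend K M (K_gt0 : (0 < K)%N) (p : 'I_K -> distr R M) j y :
  p j y <= K%:R * blend (uniform_distr K_gt0) p y.
Proof.
rewrite /= /blend_mass -mulr_sumr mulrA mulfV ?mul1r ?pnatr_eq0 -?lt0n//.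
by rewrite (bigD1 j)//= lerDl sumr_ge0// => i _; exact: mass_ge0.
Qed.

(** A difference of logarithms, so that terms can be regrouped linearly. Since [ln] has a default
    value at 0, it represents [KL] only when [q] is positive on the support of [p]. *)
Definition KLr M (p q : distr R M) : R := \sum_(y < M) p y * (ln (p y) - ln (q y)).

Lemma ln_le_subr1 (x : R) : 0 < x -> ln x <= x - 1.
Proof.
move=> x0; rewrite -[in ln x](subrK 1 x) addrC; apply: le_ln1Dx.
by rewrite ltrBrDr addrC subrr.
Qed.

Lemma KL_KLr M (p q : distr R M) :
  (forall y, 0 < p y -> 0 < q y) -> KL p q = (KLr p q)%:E.
Proof.
move=> pq; rewrite /KL /KLr -sumEFin; apply: eq_bigr => y _.
rewrite /KL_term; case: eqVneq => [->|p0]; first by rewrite mul0r.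
have p_gt0 : 0 < p y by rewrite lt0r p0 mass_ge0.
have q_gt0 := pq _ p_gt0.
by rewrite gt_eqF// ln_div// posrE.
Qed.

(** The Gibbs inequality, from ln x <= x - 1 at x = q / p. *)
Lemma KLr_ge0 M (p q : distr R M) :
  (forall y, 0 < p y -> 0 < q y) -> 0 <= KLr p q.
Proof.
move=> pq; rewrite -(subrr 1) -{1}(mass_sum1 p) -(mass_sum1 q) -sumrB.
apply: ler_sum => y _.
have [->|p0] := eqVneq (p y) 0.
  by rewrite mul0r sub0r oppr_le0 mass_ge0.
have p_gt0 : 0 < p y by rewrite lt0r p0 mass_ge0.
have q_gt0 := pq _ p_gt0.
have := ln_le_subr1 (divr_gt0 q_gt0 p_gt0).
rewrite ln_div ?posrE// => h.
rewrite -(opprB (ln (q y))) mulrN lerNr opprB.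
by apply: (le_trans (ler_wpM2l (ltW p_gt0) h)); rewrite mulrBr mulrC divfK// mulr1.
Qed.

Lemma KLr_le M (p q : distr R M) (b : R) :
  (forall y, 0 < p y -> ln (p y) - ln (q y) <= b) -> KLr p q <= b.
Proof.
move=> h; rewrite -[leRHS]mul1r -(mass_sum1 p) mulr_suml; apply: ler_sum => y _.
have [->|p0] := eqVneq (p y) 0; first by rewrite !mul0r.
by rewrite ler_wpM2l ?mass_ge0// h// lt0r p0 mass_ge0.
Qed.

Lemma blend_gt0 K M (w : distr R K) (p : 'I_K -> distr R M) y :
  (forall j, 0 < p j y) -> 0 < blend w p y.
Proof.
move=> p0; rewrite lt_neqAle mass_ge0 andbT eq_sym; apply/eqP => /= q0.
have /psumr_eq0P w0 : \sum_(j < K) w j * p j y = 0 := q0.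
have := mass_sum1 w; rewrite big1 => [/esym/eqP|j _]; first by rewrite oner_eq0.
have /eqP := w0 (fun i _ => mulr_ge0 (mass_ge0 w i) (ltW (p0 i))) j isT.
by rewrite mulf_eq0 (gt_eqF (p0 j)) orbF => /eqP.
Qed.

(** Passes to a loss linear in the weights, which is what exponential weights control. *)
Lemma KLr_blend_le K M (f : distr R M) (w : distr R K) (p : 'I_K -> distr R M) :
  (forall j y, 0 < f y -> 0 < p j y) ->
  KLr f (blend w p) <= \sum_(j < K) w j * KLr f (p j).
Proof.
move=> fp; rewrite /KLr.
under [leRHS]eq_bigr do rewrite mulr_sumr.
rewrite exchange_big /=; apply: ler_sum => y _.
have [->|f0] := eqVneq (f y) 0.
  by rewrite mul0r big1// => j _; rewrite mul0r mulr0.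
have f_gt0 : 0 < f y by rewrite lt0r f0 mass_ge0.
under eq_bigr do rewrite mulrCA.
rewrite -mulr_sumr ler_wpM2l ?mass_ge0//.
have q_gt0 : 0 < blend w p y by apply: blend_gt0 => j; exact: fp.
under eq_bigr do rewrite mulrBr.
rewrite sumrB -mulr_suml mass_sum1 mul1r lerD2l lerN2.
(* Jensen, from the tangent of ln at the blended mass *)
suff: \sum_(i < K) w i * (ln (p i y) - ln (blend w p y)) <= 0.
  under eq_bigr do rewrite mulrBr.
  by rewrite sumrB -mulr_suml mass_sum1 mul1r subr_le0.
apply: (@le_trans _ _ (\sum_(i < K) w i * (p i y / blend w p y - 1))).
  apply: ler_sum => i _; rewrite ler_wpM2l ?mass_ge0//.
  rewrite -ln_div ?posrE ?fp//.
  by apply: ln_le_subr1; rewrite divr_gt0 ?fp.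
under eq_bigr do rewrite mulrBr mulrA mulr1.
by rewrite sumrB mass_sum1 -mulr_suml divff ?subrr// gt_eqF.
Qed.

(** Smoothing keeps at least the fraction T / (T + 1) of each mass, and ln ((T + 1) / T) <= 1 /
    T. *)
Lemma KLr_smooth_le M T (f u : distr R M) :
  (0 < T)%N -> KLr f (smooth T f u) <= T%:R^-1.
Proof.
move=> T_gt0; have T0 : 0 < T%:R :> R by rewrite ltr0n.
have T1 : 0 < T%:R + 1 :> R by rewrite addr_gt0.
apply: KLr_le => y f_gt0.
have h := smooth_ge_l T f u y.
have r_gt0 : 0 < T%:R / (T%:R + 1) * f y by rewrite mulr_gt0// divr_gt0.
have : ln (T%:R / (T%:R + 1) * f y) <= ln (smooth T f u y).
  by rewrite ler_ln ?posrE// (lt_le_trans r_gt0 h).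
rewrite lnM ?posrE ?divr_gt0// -[X in ln X]invrK invf_div lnV ?posrE ?divr_gt0//.
have := ln_le_subr1 (divr_gt0 T1 T0).
rewrite mulrDl divff ?gt_eqF// mul1r [1 + _]addrC addrK => h1 h2.
lra.
Qed.

(** The smoothed mass lies between u / (T + 1) and K T u, the latter because p <= K u; and T + 1 <=
    2 T <= K T as K >= 2. *)
Lemma ln_blend_smooth_le M K T (K_gt1 : (1 < K)%N) (K_gt0 : (0 < K)%N)
    (T_gt0 : (0 < T)%N) (p : 'I_K -> distr R M) j y
    (u := blend (uniform_distr K_gt0) p) :
  `|ln (u y) - ln (smooth T (p j) u y)| <= ln ((K * T)%:R).
Proof.
have T1 : 1 <= T%:R :> R by rewrite ler1n.
have K2 : 2 <= K%:R :> R by rewrite (ler_nat R 2).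
have TK : 0 < T%:R + 1 :> R by rewrite addr_gt0// (lt_le_trans _ T1).
have KT0 : 0 < K%:R * T%:R :> R by rewrite mulr_gt0//; lra.
have hp := le_uniform_blend K_gt0 p j y; rewrite -/u in hp.
have hs := smooth_ge_r T (p j) u y.
have hu : smooth T (p j) u y <= K%:R * T%:R * u y.
  rewrite -[smooth _ _ _ _]/(smooth_mass T (p j) u y) /smooth_mass ler_pdivrMr//.
  have := ler_wpM2l (ler0n R T) hp; have := mass_ge0 u y.
  move: (u y) => v v0 h.
  apply: (le_trans (lerD h (lexx v))).
  rewrite -subr_ge0.
  have -> : K%:R * T%:R * v * (T%:R + 1) - (T%:R * (K%:R * v) + v) =
    (K%:R * T%:R * T%:R - 1) * v :> R by ring.
  rewrite mulr_ge0// subr_ge0 -!natrM ler1n !muln_gt0 T_gt0 (ltnW K_gt1)//.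
(* A label of average mass 0 has smoothed mass 0 too, so the two logarithms cancel whatever their
   default value. *)
have [u0|u_neq0] := eqVneq (u y) 0.
  have /eqP -> : smooth T (p j) u y == 0.
    by rewrite eq_le mass_ge0 andbT (le_trans hu)// u0 mulr0.
  by rewrite u0 subrr normr0 ln_ge0// ler1n muln_gt0 K_gt0.
have u_gt0 : 0 < u y by rewrite lt0r u_neq0 mass_ge0.
have s_gt0 : 0 < smooth T (p j) u y by rewrite (lt_le_trans _ hs)// divr_gt0.
move: (smooth T (p j) u y) (u y) hs hu s_gt0 u_gt0 => s v hs hu s_gt0 v_gt0.
rewrite -ln_div ?posrE// natrM ler_norml -lnV ?posrE//.
rewrite !ler_ln ?posrE ?invr_gt0 ?divr_gt0//; apply/andP; split.
  rewrite ler_pdivlMr// mulrC ler_pdivrMr//.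
  by rewrite mulrC.
rewrite ler_pdivrMr//; apply: (@le_trans _ _ ((T%:R + 1) * s)).
  by rewrite mulrC -ler_pdivrMr.
rewrite ler_wpM2r ?(ltW s_gt0)//.
have : 2 * T%:R <= K%:R * T%:R :> R by rewrite ler_wpM2r// ler0n.
lra.
Qed.

End distributions.

(** * Exponential weights *)

Section hedge.
Set Implicit Arguments.
Unset Strict Implicit.
Unset Printing Implicit Defensive.
Context {R : realType}.

Lemma expR_le_quadratic (x : R) : x <= 1 -> expR x <= 1 + x + 2 * x ^+ 2.
Proof.
move=> x1.
(* 1 - x/2 <= exp (-x/2), squared and inverted *)
have h := expR_ge1Dx (- (x / 2)).
have e : expR x * expR (- (x / 2)) ^+ 2 = 1.
  by rewrite expr2 -!expRD -[RHS](@expR0 R); congr expR; field.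
have q0 : 0 < 1 + x + 2 * x ^+ 2.
  have := sqr_ge0 (x + 1/4); rewrite !expr2; lra.
have y0 : 0 < expR (- (x / 2)) ^+ 2 by rewrite exprn_gt0 ?expR_gt0.
rewrite -(ler_pM2r y0) e.
have h2 : (1 - x / 2) ^+ 2 <= expR (- (x / 2)) ^+ 2.
  by rewrite ler_sqr ?nnegrE ?expR_ge0//; lra.
apply: le_trans (ler_wpM2l (ltW q0) h2).
(* Both 1 - x and 5/2 - x are nonnegative for x <= 1. *)
have -> : (1 + x + 2 * x ^+ 2) * (1 - x / 2) ^+ 2 =
  1 + x ^+ 2 * ((1 - x) * (5 / 2 - x)) / 2 by field.
rewrite lerDl divr_ge0// mulr_ge0 ?sqr_ge0// mulr_ge0; lra.
Qed.

Variables (K : nat) (eta : R).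
Hypothesis K_gt0 : (0 < K)%N.

Definition partition_sum (S : 'I_K -> R) := \sum_(k < K) expR (- (eta * S k)).

Lemma expR_le_partition_sum S j : expR (- (eta * S j)) <= partition_sum S.
Proof.
by rewrite /partition_sum (bigD1 j)//= lerDl sumr_ge0// => i _; exact: expR_ge0.
Qed.

Lemma partition_sum_gt0 S : 0 < partition_sum S.
Proof. exact: lt_le_trans (expR_gt0 _) (expR_le_partition_sum S (Ordinal K_gt0)). Qed.

(** A single exponential instead of a quotient: nonnegativity is immediate and measurability follows
    from that of [expR] and [ln]. *)
Definition softmax_mass S j := expR (- (eta * S j) - ln (partition_sum S)).

Lemma softmax_massE S j :
  softmax_mass S j = expR (- (eta * S j)) / partition_sum S.
Proof. by rewrite /softmax_mass expRD [expR (- ln _)]expRN lnK// posrE partition_sum_gt0. Qed.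

Lemma softmax_sum1 S : \sum_(j < K) softmax_mass S j = 1.
Proof.
under eq_bigr do rewrite softmax_massE.
by rewrite -mulr_suml divff// gt_eqF// partition_sum_gt0.
Qed.

Definition softmax S : distr R K :=
  @Distr R K (softmax_mass S) (fun=> expR_ge0 _) (softmax_sum1 S).

(** This is - ln (softmax S js) / eta. Adding [S js] to the usual log-partition potential makes it
    nonnegative, as a bound on future loss must be. *)
Definition potential (js : 'I_K) S := ln (partition_sum S) / eta + S js.

Hypothesis eta_gt0 : 0 < eta.

Lemma potential_ge0 js S : 0 <= potential js S.
Proof.
rewrite /potential -lerBlDr sub0r ler_pdivlMr// mulNr mulrC.
by rewrite -[leLHS]expRK ler_ln ?posrE ?expR_gt0 ?partition_sum_gt0//
  expR_le_partition_sum.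
Qed.

Lemma potential0 js : potential js (fun=> 0) = ln K%:R / eta.
Proof.
rewrite /potential addr0 /partition_sum mulr0 oppr0 expR0.
by rewrite sumr_const card_ord.
Qed.

(** The ratio of the new partition sum to the old is the softmax average of exp (- eta z); apply ln
    x <= x - 1, then the quadratic bound on the exponential. *)
Lemma potential_step js S (z : 'I_K -> R) : (forall j, - (eta * z j) <= 1) ->
  potential js (fun j => S j + z j) <= potential js S + z js +
    \sum_(j < K) softmax S j * (2 * eta * z j ^+ 2 - z j).
Proof.
move=> z1; rewrite /potential.
have S0 := partition_sum_gt0 S.
suff : ln (partition_sum (fun j => S j + z j)) <= ln (partition_sum S) +
    eta * \sum_(j < K) softmax S j * (2 * eta * z j ^+ 2 - z j).
  rewrite -(ler_pM2r (_ : 0 < eta^-1)) ?invr_gt0// mulrDl.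
  by rewrite [eta * _]mulrC mulfK ?gt_eqF//; lra.
rewrite -lerBlDl -ln_div ?posrE ?partition_sum_gt0//.
have -> : partition_sum (fun j => S j + z j) / partition_sum S =
    \sum_(j < K) softmax S j * expR (- (eta * z j)).
  rewrite /partition_sum mulr_suml; apply: eq_bigr => j _ /=.
  by rewrite softmax_massE mulrAC -expRD mulrDr opprD.
have s1 := mass_sum1 (softmax S).
apply: (@le_trans _ _ (\sum_(j < K) softmax S j * (expR (- (eta * z j)) - 1))).
  under [leRHS]eq_bigr do rewrite mulrBr mulr1.
  rewrite sumrB s1; apply: ln_le_subr1.
  rewrite (bigD1 (Ordinal K_gt0))//= ltr_wpDr ?mulr_gt0 ?expR_gt0//.
  by apply: sumr_ge0 => i _; rewrite mulr_ge0 ?expR_ge0.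
rewrite mulr_sumr; apply: ler_sum => j _.
rewrite mulrCA ler_wpM2l ?mass_ge0//.
have := expR_le_quadratic (z1 j).
lra.
Qed.

(** Averaging [potential_step] over the outcome cancels the linear terms. The second moment [v] is
    the same in all coordinates, so the softmax weights drop out of it. *)
Lemma expected_potential_step js S N (q : distr R N) (z : 'I_N -> 'I_K -> R)
    (m : 'I_K -> R) (v : R) :
  (forall a j, - (eta * z a j) <= 1) ->
  (forall j, \sum_(a < N) q a * z a j = m j) ->
  (forall j, \sum_(a < N) q a * z a j ^+ 2 = v) ->
  \sum_(j < K) softmax S j * m j +
    \sum_(a < N) q a * potential js (fun j => S j + z a j)
  <= potential js S + (m js + 2 * eta * v).
Proof.
move=> z1 qm qv.
have -> : \sum_(j < K) softmax S j * m j =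
    \sum_(a < N) q a * \sum_(j < K) softmax S j * z a j.
  under eq_bigr => j _ do rewrite -qm mulr_sumr.
  rewrite exchange_big; apply: eq_bigr => a _ /=.
  by rewrite mulr_sumr; apply: eq_bigr => j _; rewrite mulrCA.
have V : \sum_(a < N) q a * (\sum_(j < K) softmax S j * z a j ^+ 2) = v.
  under eq_bigr => a _ do rewrite mulr_sumr.
  rewrite exchange_big /=.
  under eq_bigr => j _.
    under eq_bigr do rewrite mulrCA.
    rewrite -mulr_sumr qv.
    over.
  by rewrite -mulr_suml (mass_sum1 (softmax S)) mul1r.
rewrite -big_split /=.
apply: (@le_trans _ _ (\sum_(a < N) (q a * potential js S + q a * z a js +
    2 * eta * (q a * (\sum_(j < K) softmax S j * z a j ^+ 2))))).
  apply: ler_sum => a _.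
  rewrite -mulrDr [2 * eta * _]mulrCA -!mulrDr ler_wpM2l ?mass_ge0//.
  have := potential_step js S (z1 a).
  have -> : \sum_(j < K) softmax S j * (2 * eta * z a j ^+ 2 - z a j) =
      2 * eta * (\sum_(j < K) softmax S j * z a j ^+ 2) -
      \sum_(j < K) softmax S j * z a j.
    by rewrite mulr_sumr -sumrB; apply: eq_bigr => j _; rewrite mulrBr mulrCA.
  lra.
by rewrite !big_split/= -mulr_suml mass_sum1 mul1r qm -mulr_sumr V addrA.
Qed.

End hedge.

(** * Randomized response on a random coordinate *)

Section mechanism.
Set Implicit Arguments.
Unset Strict Implicit.
Unset Printing Implicit Defensive.
Context {R : realType}.
Variable K : nat.

(* 'I_(K + K) encodes the pairs of a coordinate and a sign. *)
Definition coin_index (a : 'I_(K + K)) : 'I_K :=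
  match fintype.split a with inl j => j | inr j => j end.

Definition coin_sign (a : 'I_(K + K)) : R :=
  match fintype.split a with inl _ => 1 | inr _ => -1 end.

Lemma sum_coin (V : nmodType) (F : R -> 'I_K -> V) :
  \sum_(a < K + K) F (coin_sign a) (coin_index a) =
  \sum_(j < K) (F 1 j + F (-1) j).
Proof.
rewrite big_split_ord big_split; congr (_ + _); apply: eq_bigr => j _;
by rewrite /coin_sign /coin_index ?(unsplitK (inl j)) ?(unsplitK (inr j)).
Qed.

Lemma normr_coin_sign a : `|coin_sign a| = 1.
Proof. by rewrite /coin_sign; case: fintype.split => _; rewrite ?normrN normr1. Qed.

Variable rho : R.
Hypothesis K_gt0 : (0 < K)%N.
Hypothesis rho_itv : 0 <= rho <= 1.

Definition response_mass (r : 'I_K -> R) a :=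
  (1 + rho * (coin_sign a * r (coin_index a))) / 2 / K%:R.

Lemma signal_bound (r : 'I_K -> R) (r1 : forall j, `|r j| <= 1) a :
  1 - rho <= 1 + rho * (coin_sign a * r (coin_index a)) <= 1 + rho.
Proof.
have [rho0 _] := andP rho_itv.
have : `|rho * (coin_sign a * r (coin_index a))| <= rho.
  by rewrite !normrM normr_coin_sign mul1r ger0_norm// ler_piMr.
by rewrite ler_norml => /andP[h1 h2]; apply/andP; split; lra.
Qed.

Lemma response_ge0 r (r1 : forall j, `|r j| <= 1) a : 0 <= response_mass r a.
Proof.
have /andP[h _] := signal_bound r1 a; have /andP[_ rho1] := rho_itv.
by rewrite !divr_ge0// (le_trans _ h)// subr_ge0.
Qed.

Lemma response_sum1 r : \sum_(a < K + K) response_mass r a = 1.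
Proof.
rewrite (sum_coin (fun s j => (1 + rho * (s * r j)) / 2 / K%:R)).
rewrite -[RHS](@uniform_sum1 R _ K_gt0); apply: eq_bigr => j _.
by field; rewrite pnatr_eq0 -lt0n.
Qed.

Definition response r (r1 : forall j, `|r j| <= 1) : distr R (K + K) :=
  Distr (response_ge0 r1) (response_sum1 r).

(** All signals lie between 1 - rho and 1 + rho, whose ratio is [e]. *)
Lemma response_le (e : R) r r' (r1 : forall j, `|r j| <= 1)
    (r1' : forall j, `|r' j| <= 1) a :
  1 + rho = e * (1 - rho) -> 0 <= e ->
  response r1 a <= e * response r1' a.
Proof.
move=> rhoE e0; rewrite /= /response_mass [e * _]mulrA [e * (_ / 2)]mulrA.
rewrite ler_wpM2r ?invr_ge0 ?ler0n// ler_wpM2r ?invr_ge0//.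
have /andP[_ h] := signal_bound r1 a; have /andP[h' _] := signal_bound r1' a.
by apply: (le_trans h); rewrite rhoE ler_wpM2l.
Qed.

Definition released (B : R) a : private_label R K :=
  [tuple B * (coin_sign a * (i == coin_index a)%:R) | i < K].

(** Coordinate [i] is chosen with probability 1 / K, and its sign then has mean rho r_i. *)
Lemma released_mean B r (r1 : forall j, `|r j| <= 1) i :
  \sum_(a < K + K) response r1 a * tnth (released B a) i =
  B * rho / K%:R * r i.
Proof.
under eq_bigr do rewrite tnth_mktuple.
rewrite (sum_coin (fun s j => (1 + rho * (s * r j)) / 2 / K%:R *
  (B * (s * (i == j)%:R)))) (bigD1 i)//= big1 => [|j ji].
  by rewrite eqxx addr0 /=; field; rewrite pnatr_eq0 -lt0n.
by rewrite eq_sym (negbTE ji) !mulr0 addr0.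
Qed.

(** Squaring forgets the sign, so nothing depends on [r] or [i]. *)
Lemma released_sqr_mean B r (r1 : forall j, `|r j| <= 1) i :
  \sum_(a < K + K) response r1 a * tnth (released B a) i ^+ 2 =
  B ^+ 2 / K%:R.
Proof.
under eq_bigr do rewrite tnth_mktuple.
rewrite (sum_coin (fun s j => (1 + rho * (s * r j)) / 2 / K%:R *
  (B * (s * (i == j)%:R)) ^+ 2)) (bigD1 i)//= big1 => [|j ji].
  by rewrite eqxx addr0 /=; field; rewrite pnatr_eq0 -lt0n.
by rewrite eq_sym (negbTE ji) !mulr0 expr0n/= !mulr0 addr0.
Qed.

Lemma normr_released B a i : `|tnth (released B a) i| <= `|B|.
Proof.
rewrite tnth_mktuple !normrM normr_coin_sign mul1r ler_piMr//.
by case: eqP => _; rewrite ?normr1 ?normr0.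
Qed.

Definition randomize (B : R) r (r1 : forall j, `|r j| <= 1) :
    probability (private_label R K) R :=
  [the probability _ R of mixture (response r1)
    (fun a => [the probability (private_label R K) R of \d_(released B a)])].

(** The released vector takes finitely many values; this is the finite-sum form required by
    [online_integral_le]. *)
Lemma ge0_integral_randomize B M (f : distr R M) (r : 'I_M -> 'I_K -> R)
    (r1 : forall y j, `|r y j| <= 1) (F : private_label R K -> \bar R) :
  measurable_fun setT F -> (forall z, 0 <= F z)%E ->
  (\int[mixture f (fun y => randomize B (r1 y))]_z F z =
   \sum_(a < K + K) (blend f (fun y => response (r1 y)) a)%:E *
     F (released B a))%E.
Proof.
move=> mF F0; rewrite ge0_integral_mixture//.
under eq_bigr => y _.
  rewrite ge0_integral_mixture//.
  under eq_bigr do rewrite integral_dirac// diracT mul1e.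
  rewrite ge0_sume_distrr; last first.
    by move=> a _; rewrite mule_ge0// lee_fin mass_ge0.
  over.
rewrite exchange_big /=; apply: eq_bigr => a _.
rewrite -sumEFin ge0_sume_distrl; last first.
  by move=> y _; rewrite lee_fin mulr_ge0 ?mass_ge0 ?response_ge0.
by apply: eq_bigr => y _; rewrite muleA EFinM.
Qed.

(** The point masses do not depend on the label, so it is enough to compare their weights. *)
Lemma locally_private_randomize eps d M T B
    (r : feature R d -> 'I_M -> 'I_K -> R) (r1 : forall x y j, `|r x y j| <= 1) :
  1 + rho = expR eps * (1 - rho) ->
  locally_private eps 0 ((fun _ x y => randomize B (r1 x y))
    : privatization R d M K T).
Proof.
move=> rhoE t x y y' S mS; rewrite adde0 /= /mixture.
rewrite ge0_sume_distrr; last first.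
  by move=> a _; rewrite mule_ge0// lee_fin response_ge0.
apply: lee_sum => a _; rewrite muleA lee_wpmul2r//.
by rewrite -EFinM lee_fin; apply: response_le => //; exact: expR_ge0.
Qed.

End mechanism.

(** * The learner and its regret *)

Section learner.
Set Implicit Arguments.
Unset Strict Implicit.
Unset Printing Implicit Defensive.
Context {R : realType}.
Variable K : nat.

Definition add_score (S : 'I_K -> R) (z : private_label R K) : 'I_K -> R :=
  fun j => S j + tnth z j.

Lemma foldl_add_scoreE S (s : seq (private_label R K)) j :
  foldl add_score S s j = S j + \sum_(z <- s) tnth z j.
Proof.
elim: s S => [|z s IHs] S /=; first by rewrite big_nil addr0.
by rewrite IHs big_cons addrA.
Qed.

Lemma measurable_score t S j : measurable_fun [set: t.-tuple (private_label R K)]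
  (fun zs => foldl add_score S zs j : R).
Proof.
under eq_fun do rewrite foldl_add_scoreE big_tuple.
apply: measurable_funD => //; apply: measurable_sum => i.
exact: (measurableT_comp (measurable_tnth j) (measurable_tnth i)).
Qed.

Lemma val_first_entries A T n (nT : (n <= T)%N) (s : T.-tuple A) :
  first_entries nT s = take n s :> seq A.
Proof.
(* For n > 0 the tuple itself supplies the default element that [nth] needs. *)
case: n nT => [|n] nT; first by rewrite take0; apply/size0nil; rewrite size_tuple.
have x0 : A := tnth s (widen_ord nT ord0).
apply: (@eq_from_nth _ x0); first by rewrite size_tuple size_takel ?size_tuple.
move=> i; rewrite size_tuple => iT.
rewrite -[i]/(nat_of_ord (Ordinal iT)) -tnth_nth tnth_mktuple nth_take//.
by rewrite (tnth_nth x0).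
Qed.

Lemma measurable_first_entries dd (Z : measurableType dd) T n (nT : (n <= T)%N) :
  measurable_fun [set: T.-tuple Z] (@first_entries Z T n nT).
Proof.
apply/measurable_fun_tnthP => i.
rewrite (_ : _ \o _ = (fun s => tnth s (widen_ord nT i))).
  exact: measurable_tnth.
by apply/funext => s; rewrite /= tnth_mktuple.
Qed.

Hypothesis K_gt0 : (0 < K)%N.

Lemma measurable_softmax eta dd (Z : measurableType dd) (S : Z -> 'I_K -> R) j :
  (forall i, measurable_fun setT (fun z => S z i)) ->
  measurable_fun setT (fun z => softmax eta K_gt0 (S z) j).
Proof.
move=> mS; have mN i : measurable_fun setT (fun z => - (eta * S z i)).
  by apply: measurable_funN; apply: measurable_funM.
apply: (measurableT_comp (@measurable_expR R)).
apply: measurable_funB => //.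
apply: (measurableT_comp (@measurable_ln R)).
apply: measurable_sum => i.
exact: (measurableT_comp (@measurable_expR R)).
Qed.

Variables (d M T : nat) (F : 'I_K -> feature R d -> distr R M).
Hypothesis T_gt0 : (0 < T)%N.

Definition average x : distr R M :=
  blend (@uniform_distr R _ K_gt0) (fun j => F j x).

Definition expert j x : distr R M := smooth T (F j x) (average x).

(** The feature tuple has t + 1 entries, so [ord_max] points at the current feature. *)
Definition hedge_prediction eta : prediction R d M K T := fun t xs zs =>
  blend (softmax eta K_gt0 (foldl add_score (fun=> 0) zs))
    (fun j => expert j (tnth xs ord_max)).

Lemma measurable_hedge_prediction eta :
  measurable_prediction (hedge_prediction eta).
Proof.
move=> t xs y; apply: measurable_sum => j.
apply: measurable_funM => //.
by apply: measurable_softmax => i; exact: measurable_score.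
Qed.

Lemma average_gt0 j x y : 0 < F j x y -> 0 < average x y.
Proof.
move=> f_gt0; have := lt_le_trans f_gt0 (le_uniform_blend K_gt0 (F^~ x) j y).
by rewrite pmulr_rgt0// ltr0n.
Qed.

(** Every expert contains the average, hence a share of every member of the class; so no divergence
    in the risk is infinite. *)
Lemma expert_gt0 i j x y : 0 < F i x y -> 0 < expert j x y.
Proof.
move=> f_gt0; apply: lt_le_trans (smooth_ge_r T (F j x) (average x) y).
by rewrite divr_gt0 ?(average_gt0 f_gt0)// addr_gt0 ?ltr0n.
Qed.

(* The first term does not depend on j, so the expected losses of the experts
   differ by the same amounts as their divergences from F i x. *)
Lemma KLr_expertE i j x :
  KLr (F i x) (expert j x) = KLr (F i x) (average x) +
  \sum_(y < M) F i x y * (ln (average x y) - ln (expert j x y)).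
Proof.
rewrite /KLr -big_split; apply: eq_bigr => y _ /=.
by rewrite -mulrDr addrA subrK.
Qed.

Lemma hedge_regret (rho L eta : R) (js : 'I_K) (xs : T.-tuple (feature R d))
  (rho_itv : 0 <= rho <= 1)
  (r1 : forall x y j,
     `|(ln (average x y) - ln (expert j x y)) / L| <= 1) :
  let B := L * K%:R / rho in
  0 < rho -> 0 < L -> 0 < eta -> eta * B <= 1 ->
  (KL_risk (fun _ x y => randomize K_gt0 rho_itv B (r1 x y))
      (hedge_prediction eta) (F js) xs
   <= (ln K%:R / eta + 1 + 2 * T%:R * eta * (B ^+ 2 / K%:R))%:E)%E.
Proof.
move=> B rho0 L0 eta0 etaB.
have B0 : 0 < B by rewrite divr_gt0// mulr_gt0// ltr0n.
pose h (t : 'I_T) S := \sum_(j < K) softmax eta K_gt0 S j *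
  KLr (F js (tnth xs t)) (expert j (tnth xs t)).
have KLE (t : 'I_T) zs : KL (F js (tnth xs t))
    (hedge_prediction eta (first_entries (ltn_ord t) xs)
       (first_entries (ltnW (ltn_ord t)) zs)) =
  (KLr (F js (tnth xs t))
    (blend (softmax eta K_gt0 (foldl add_score (fun=> 0) (take t zs)))
      (fun j => expert j (tnth xs t))))%:E.
  have -> : hedge_prediction eta (first_entries (ltn_ord t) xs)
      (first_entries (ltnW (ltn_ord t)) zs) =
    blend (softmax eta K_gt0 (foldl add_score (fun=> 0) (take t zs)))
      (fun j => expert j (tnth xs t)).
    rewrite /hedge_prediction val_first_entries tnth_mktuple.
    by rewrite (_ : widen_ord _ _ = t)//; exact: val_inj.
  by apply: KL_KLr => y f_gt0; apply: blend_gt0 => j; exact: expert_gt0 f_gt0.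
have mtake (t : 'I_T) j : measurable_fun [set: T.-tuple (private_label R K)]
    (fun zs => foldl add_score (fun=> 0) (take t zs) j : R).
  rewrite (_ : (fun _ => _) = (fun zs =>
      foldl add_score (fun=> 0) (first_entries (ltnW (ltn_ord t)) zs) j)).
    apply: (measurableT_comp (@measurable_score t (fun=> 0) j)).
    exact: measurable_first_entries.
  by apply/funext => zs; rewrite val_first_entries.
have mw (t : 'I_T) j : measurable_fun [set: T.-tuple (private_label R K)]
    (fun zs => softmax eta K_gt0 (foldl add_score (fun=> 0) (take t zs)) j : R).
  exact: measurable_softmax.
have mh t : measurable_fun [set: T.-tuple (private_label R K)]
    (fun zs => h t (foldl add_score (fun=> 0) (take t zs)) : R).
  by apply: measurable_sum => j; exact: measurable_funM.
(* Convexity replaces the divergence of the blend by the linear loss [h], to which the potential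
   argument applies. *)
apply: (@le_trans _ _ (\int[private_law
      (fun _ x y => randomize K_gt0 rho_itv B (r1 x y)) (F js) xs]_zs
    (\sum_(t < T) h t (foldl add_score (fun=> 0) (take t zs)))%:E)%E).
  rewrite /KL_risk; apply: ge0_le_integral => //.
  - move=> zs _; apply: sume_ge0 => t _; rewrite KLE lee_fin.
    apply: KLr_ge0 => y f_gt0; apply: blend_gt0 => j; exact: expert_gt0 f_gt0.
  - apply: emeasurable_sum => t.
    under eq_fun do rewrite KLE.
    apply/measurable_EFinP/measurable_sum => y.
    apply: measurable_funM => //; apply: measurable_funB => //.
    apply: (measurableT_comp (@measurable_ln R)).
    by apply: measurable_sum => j; exact: measurable_funM.
  - by apply/measurable_EFinP/measurable_sum.
  - move=> zs _; rewrite -sumEFin; apply: lee_sum => t _.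
    rewrite KLE lee_fin; apply: KLr_blend_le => j y; exact: expert_gt0.
(* The smoothing cost of the comparator and the second-moment term of one round. *)
pose c := T%:R^-1 + 2 * eta * (B ^+ 2 / K%:R).
have -> : ln K%:R / eta + 1 + 2 * T%:R * eta * (B ^+ 2 / K%:R) =
    potential eta js (fun=> 0) + T%:R * c.
  rewrite potential0 /c; field.
  by rewrite (gt_eqF eta0) ?pnatr_eq0 -?lt0n ?K_gt0 ?T_gt0.
rewrite /private_law.
apply: (@online_integral_le _ _ _ _ add_score (potential eta js) c _
  (released B) _
  (fun t => mixture (F js (tnth xs t))
    (fun y => randomize K_gt0 rho_itv B (r1 (tnth xs t) y)))
  (fun t => blend (F js (tnth xs t))
    (fun y => response K_gt0 rho_itv (r1 (tnth xs t) y)))) => //.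
- by move=> S; exact: potential_ge0.
- move=> t S; apply: sumr_ge0 => j _; rewrite mulr_ge0 ?mass_ge0//.
  by apply: KLr_ge0 => y; exact: expert_gt0.
- by move=> t G mG G0; exact: ge0_integral_randomize.
move=> t S; set x := tnth xs t.
(* The expert losses less their common term [KLr (F js x) (average x)], which may be large; only
   these bounded differences are estimated. *)
pose m j := \sum_(y < M) F js x y * (ln (average x y) - ln (expert j x y)).
have hS : h t S = KLr (F js x) (average x) +
    \sum_(j < K) softmax eta K_gt0 S j * m j.
  rewrite /h; under eq_bigr do rewrite KLr_expertE mulrDr.
  by rewrite big_split /= -mulr_suml (mass_sum1 (softmax eta K_gt0 S)) mul1r.
have hj : KLr (F js x) (average x) + m js <= T%:R^-1.
  by rewrite -KLr_expertE; exact: KLr_smooth_le.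
have B1 (a : 'I_(K + K)) j : - (eta * tnth (released B a) j) <= 1.
  apply: (le_trans (ler_norm _)); rewrite normrN normrM gtr0_norm//.
  apply: le_trans etaB; rewrite ler_wpM2l ?(ltW eta0)//.
  by rewrite -[leRHS](gtr0_norm B0) normr_released.
pose q := blend (F js x) (fun y => response K_gt0 rho_itv (r1 x y)).
(* Unbiasedness: B = L K / rho cancels the factors rho, 1 / K and 1 / L. *)
have q_mean j : \sum_(a < K + K) q a * tnth (released B a) j = m j.
  rewrite sum_blend; apply: eq_bigr => y _; rewrite released_mean /B.
  by congr (_ * _); field; rewrite !gt_eqF// ltr0n.
have q_sqr_mean j :
    \sum_(a < K + K) q a * tnth (released B a) j ^+ 2 = B ^+ 2 / K%:R.
  rewrite sum_blend; under eq_bigr do rewrite released_sqr_mean.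
  by rewrite -mulr_suml mass_sum1 mul1r.
have := expected_potential_step K_gt0 eta0 js S B1 q_mean q_sqr_mean.
rewrite hS /c /add_score -/q; lra.
Qed.

(** Each member is at most K times the average, so a round costs at most ln K. *)
Lemma average_risk (priv : privatization R d M K T) js xs :
  (KL_risk priv (fun t xs _ => average (tnth xs ord_max)) (F js) xs
   <= (T%:R * ln K%:R)%:E)%E.
Proof.
have KLE (t : 'I_T) : KL (F js (tnth xs t))
    (average (tnth (first_entries (ltn_ord t) xs) ord_max)) =
  (KLr (F js (tnth xs t)) (average (tnth xs t)))%:E.
  rewrite tnth_mktuple (_ : widen_ord _ _ = t); last exact: val_inj.
  by apply: KL_KLr => y; exact: average_gt0.
rewrite /KL_risk integral_probability_cst.
under eq_bigr do rewrite KLE.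
rewrite sumEFin lee_fin mulr_natl -[X in _ *+ X]card_ord -sumr_const.
apply: ler_sum => t _; apply: KLr_le => y f_gt0.
have u_gt0 := average_gt0 f_gt0.
rewrite lerBlDr -lnM ?posrE ?ltr0n// ler_ln ?posrE// ?mulr_gt0 ?ltr0n//.
exact: le_uniform_blend.
Qed.

End learner.

(** * The bias of the signs and the logarithmic factors *)

Section tuning.
Set Implicit Arguments.
Unset Strict Implicit.
Unset Printing Implicit Defensive.
Context {R : realType}.

(* The largest bias of a sign that is compatible with eps-local privacy. *)
Definition bias (eps : R) := (expR eps - 1) / (expR eps + 1).

Lemma bias_privacy (eps : R) : 1 + bias eps = expR eps * (1 - bias eps).
Proof. by rewrite /bias; field; rewrite gt_eqF// addr_gt0 ?expR_gt0. Qed.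

Lemma bias_gt0 (eps : R) : 0 < eps -> 0 < bias eps.
Proof.
by move=> e0; rewrite divr_gt0 ?subr_gt0 ?expR_gt1// addr_gt0 ?expR_gt0.
Qed.

Lemma bias_itv (eps : R) : 0 < eps -> 0 <= bias eps <= 1.
Proof.
move=> e0; rewrite ltW ?bias_gt0//= ler_pdivrMr ?addr_gt0 ?expR_gt0//.
by rewrite mul1r lerD2l; lra.
Qed.

(** From exp eps - 1 >= eps. The inverse bias stays above 1 as eps grows, so a bound of order 1 /
    eps needs the ceiling [eps0]. *)
Lemma biasV_le (eps0 eps : R) : 0 < eps -> eps <= eps0 ->
  (bias eps)^-1 <= (expR eps0 + 1) / eps.
Proof.
move=> e0 ele; rewrite /bias invf_div ler_pM ?addr_ge0 ?expR_ge0//.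
- by rewrite invr_ge0 subr_ge0 ltW ?expR_gt1.
- by rewrite lerD2r ler_expR.
by rewrite lef_pV2 ?posrE ?subr_gt0 ?expR_gt1// lerBrDl expR_ge1Dx.
Qed.

Lemma ln2_ge_half : 1 / 2 <= ln 2 :> R.
Proof.
have := @ln_le_subr1 R 2^-1 _; rewrite invr_gt0 ltr0n => /(_ isT).
by rewrite lnV ?posrE ?ltr0n//; lra.
Qed.

(** With N = K T and L = ln N, the first square is at most N L^3, and L >= 1/2 gives 4 L^2 >= 1,
    hence N L^3 <= 4 N L^5. The second bound absorbs additive constants. *)
Lemma sqrt_le_log5 (K T : nat) : (1 < K)%N -> (0 < T)%N ->
  let Q := Num.sqrt ((K * T)%:R * ln ((K * T)%:R) ^+ 5) : R in
  Num.sqrt ((T * K)%:R * ln K%:R) * ln ((K * T)%:R) <= 2 * Q /\ 1 <= 4 * Q.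
Proof.
move=> K_gt1 T_gt0 Q.
have KT2 : (2 <= K * T)%N by rewrite -[2%N]muln1 leq_mul.
have L1 : ln K%:R <= ln (K * T)%:R :> R.
  rewrite ler_ln ?posrE ?ltr0n ?(ltnW KT2) ?(ltnW K_gt1)// ler_nat.
  by rewrite leq_pmulr.
have L2 : 1 / 2 <= ln (K * T)%:R :> R.
  apply: le_trans ln2_ge_half _; rewrite ler_ln ?posrE ?ltr0n ?(ltnW KT2)//.
  by rewrite (ler_nat R 2).
have KT2' : 2 <= (K * T)%:R :> R by rewrite (ler_nat R 2).
have lnK0 : 0 <= ln K%:R :> R by rewrite ln_ge0// ler1n ltnW.
rewrite mulnC /Q {Q}; move: (K * T)%:R (ln K%:R) (ln (K * T)%:R) lnK0 L1 L2 KT2'.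
move=> N a L a0 aL L2 N2; have L0 : 0 <= L by lra.
have NL5 : 0 <= N * L ^+ 5 by rewrite mulr_ge0 ?exprn_ge0//; lra.
have L4 : 1 <= 4 * L ^+ 2.
  have := ler_pM (_ : 0 <= 1 / 2) (_ : 0 <= 1 / 2) L2 L2.
  by rewrite expr2 => h; have {}h := h ltac:(lra) ltac:(lra); lra.
have L3 : 0 <= N * L ^+ 3 by rewrite mulr_ge0 ?exprn_ge0//; lra.
have N3 : N * L ^+ 3 <= 4 * (N * L ^+ 5).
  have -> : 4 * (N * L ^+ 5) = N * L ^+ 3 * (4 * L ^+ 2) by ring.
  by rewrite ler_peMr.
split.
  rewrite -ler_sqr ?nnegrE ?mulr_ge0 ?sqrtr_ge0// !exprMn !sqr_sqrtr//; last first.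
    by rewrite mulr_ge0//; lra.
  apply: (@le_trans _ _ (N * L ^+ 3)); last by rewrite -natrX.
  have -> : N * L ^+ 3 = N * L * L ^+ 2 by ring.
  by rewrite ler_wpM2r ?sqr_ge0// ler_wpM2l//; lra.
rewrite -ler_sqr ?nnegrE ?mulr_ge0 ?sqrtr_ge0// exprMn sqr_sqrtr// expr1n.
(* 16 N L^5 is grouped into N >= 2, L >= 1/2 and two factors 4 L^2 >= 1. *)
have : 2 * (1 / 2) <= N * (4 * L ^+ 2 * (L * (4 * L ^+ 2))).
  rewrite ler_pM//; try lra.
  apply: (le_trans L2); rewrite -[leLHS]mul1r ler_pM//.
  by rewrite ler_peMr.
have -> : N * (4 * L ^+ 2 * (L * (4 * L ^+ 2))) = 16 * (N * L ^+ 5) by ring.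
rewrite expr2; lra.
Qed.

End tuning.

(** * Choice of the learning rate and the two regimes of the horizon *)

Theorem theorem2 (R : realType) (eps0 : R) (eps0_gt0 : 0 < eps0) :
  exists2 C : R, 0 < C &
  forall (eps : R) (eps_gt0 : 0 < eps) (eps_le : eps <= eps0)
    (d M K T : nat) (d_gt0 : (0 < d)%N) (M_gt0 : (0 < M)%N)
    (K_gt0 : (0 < K)%N) (T_gt0 : (0 < T)%N)
    (F : 'I_K -> feature R d -> distr R M),
  exists (priv : privatization R d M K T) (Phi : prediction R d M K T),
  [/\ locally_private eps 0 priv,
      measurable_prediction Phi &
      (ereal_sup [set KL_risk priv Phi (F j) xs
                 | j in [set: 'I_K] & xs in [set: T.-tuple (feature R d)]]
       <= (C * (eps^-1 * Num.sqrt ((K * T)%:R * ln ((K * T)%:R) ^+ 5)))%:E)%E].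
Proof.
have E0 : 0 < expR eps0 + 1 by rewrite addr_gt0 ?expR_gt0.
(* The first summand pays for 3 s L / rho, the second for the additive 1 left by smoothing. *)
exists (6 * (expR eps0 + 1) + 4 * eps0); first by lra.
move=> eps eps_gt0 eps_le d M K T _ _ K_gt0 T_gt0 F.
set Q := Num.sqrt _.
have Q0 : 0 <= Q by exact: sqrtr_ge0.
have epsV : 1 <= eps0 / eps by rewrite ler_pdivlMr// mul1r.
have K0 : 0 < K%:R :> R by rewrite ltr0n.
have T0 : 0 < T%:R :> R by rewrite ltr0n.
have lnK0 : 0 <= ln K%:R :> R by rewrite ln_ge0// ler1n.
pose s := Num.sqrt ((T * K)%:R * ln K%:R) : R.
have s0 : 0 <= s by exact: sqrtr_ge0.
have ss : s ^+ 2 = T%:R * K%:R * ln K%:R.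
  by rewrite sqr_sqrtr ?natrM// mulr_ge0// mulr_ge0// ler0n.
pose L := ln ((K * T)%:R) : R.
have sup_le (priv : privatization R d M K T) Phi (b : R) :
    (forall j xs, KL_risk priv Phi (F j) xs <= b%:E)%E ->
    b <= (6 * (expR eps0 + 1) + 4 * eps0) * (eps^-1 * Q) ->
    (ereal_sup [set KL_risk priv Phi (F j) xs
      | j in [set: 'I_K] & xs in [set: T.-tuple (feature R d)]]
    <= ((6 * (expR eps0 + 1) + 4 * eps0) * (eps^-1 * Q))%:E)%E.
  move=> hb bC; apply: ge_ereal_sup => _ [j _ [xs _ <-]].
  by apply: le_trans (hb j xs) _; rewrite lee_fin.
have [/andP[K_gt1 KT]|small] :=
  boolP ((1 < K)%N && (K%:R * ln K%:R <= T%:R :> R)).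
- have [sL Q1] := @sqrt_le_log5 R K T K_gt1 T_gt0; rewrite -/Q -/s -/L in sL Q1.
  have L0 : 0 < L by rewrite ln_gt0// ltr1n (leq_trans K_gt1)// leq_pmulr.
  have lnK_gt0 : 0 < ln K%:R :> R by rewrite ln_gt0// ltr1n.
  have s_gt0 : 0 < s by rewrite sqrtr_gt0 natrM !mulr_gt0.
  have rho0 := bias_gt0 eps_gt0.
  have r1 x y j :
      `|(ln (average K_gt0 F x y) - ln (expert K_gt0 T F j x y)) / L| <= 1.
    rewrite normrM normfV (gtr0_norm L0) ler_pdivrMr// mul1r.
    exact: ln_blend_smooth_le.
  pose B := L * K%:R / bias eps.
  (* As s^2 = T K ln K, this makes ln K / eta equal to s L / rho and the second-moment term equal to
     2 s L / rho. *)
  pose eta := s * bias eps / (T%:R * K%:R * L).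
  exists (fun _ x y => randomize K_gt0 (bias_itv eps_gt0) B (r1 x y)).
  exists (hedge_prediction K_gt0 F eta); split.
  + by apply: locally_private_randomize; exact: bias_privacy.
  + exact: measurable_hedge_prediction.
  have eta0 : 0 < eta by apply: divr_gt0; rewrite ?(mulr_gt0 s_gt0)// !mulr_gt0.
  apply: sup_le => [j xs|].
    apply: hedge_regret => //.
    (* So [eta] is admissible when s <= T, that is, when K ln K <= T. *)
    have -> : eta * (L * K%:R / bias eps) = s / T%:R.
      by rewrite /eta; field; rewrite !gt_eqF.
    rewrite ler_pdivrMr// mul1r -ler_sqr ?nnegrE ?ler0n// ss expr2 -mulrA.
    by rewrite ler_wpM2l.
  have -> : ln K%:R / eta + 1 + 2 * T%:R * eta * (B ^+ 2 / K%:R) =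
      3 * (s * L) * (bias eps)^-1 + 1.
    have -> : ln K%:R = s ^+ 2 / (T%:R * K%:R).
      by rewrite ss mulrC mulrA mulVf ?mul1r// gt_eqF// mulr_gt0.
    by rewrite /eta /B; field; rewrite !gt_eqF.
  have h1 : 3 * (s * L) * (bias eps)^-1 <= 3 * (2 * Q) * ((expR eps0 + 1) / eps).
    by rewrite ler_pM ?mulr_ge0 ?invr_ge0 ?ler_wpM2l ?biasV_le// ltW.
  have h2 : 1 <= 4 * Q * (eps0 / eps).
    by rewrite -[leLHS]mulr1 ler_pM.
  apply: (le_trans (lerD h1 h2)); rewrite le_eqVlt; apply/orP; left.
  by apply/eqP; field; rewrite gt_eqF.
(* Short horizon or K = 1: with zero signal and scale 0 the zero vector is always released. *)
pose r0 (_ : feature R d) (_ : 'I_M) (_ : 'I_K) : R := 0.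
have r1 x y j : `|r0 x y j| <= 1 by rewrite normr0.
exists (fun _ x y => randomize K_gt0 (bias_itv eps_gt0) 0 (r1 x y)).
exists (fun t xs _ => average K_gt0 F (tnth xs ord_max)); split.
- by apply: locally_private_randomize; exact: bias_privacy.
- by move=> t xs y; exact: measurable_cst.
apply: (sup_le _ _ (T%:R * ln K%:R)) => [j xs|]; first exact: average_risk.
(* For K = 1 the target may vanish (when T = 1), but the risk bound is T ln 1 = 0. *)
have [K_gt1|K1] := ltnP 1 K; last first.
  have -> : K = 1%N by apply/eqP; rewrite eqn_leq K1.
  by rewrite ln1 mulr0 !mulr_ge0 ?invr_ge0// ?addr_ge0 ?mulr_ge0 ?ltW.
have [sL _] := @sqrt_le_log5 R K T K_gt1 T_gt0; rewrite -/Q -/s -/L in sL.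
rewrite K_gt1 /= -ltNge in small.
have Ts : T%:R <= s.
  by rewrite -ler_sqr ?nnegrE// ?ler0n// ss expr2 -mulrA ler_wpM2l// ltW.
have LK : ln K%:R <= L.
  by rewrite ler_ln ?posrE// ?ltr0n ?muln_gt0 ?K_gt0// ler_nat leq_pmulr.
have h1 : T%:R * ln K%:R <= 2 * Q by apply: le_trans sL; rewrite ler_pM// ltW.
have h2 : 2 * Q <= 2 * Q * (eps0 / eps) by rewrite ler_peMr ?mulr_ge0.
apply: (le_trans h1); apply: (le_trans h2).
have -> : 2 * Q * (eps0 / eps) = 2 * eps0 * (eps^-1 * Q) by field; rewrite gt_eqF.
by rewrite ler_wpM2r ?mulr_ge0 ?invr_ge0 ?(ltW eps_gt0)//; lra.
Qed.
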